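(* Let $\alpha,\beta$ be odd positive integers with $\gcd(\alpha,\beta)=1$ and let $C=C_{\alpha,\beta}$ be the generalized accelerated Collatz map. Then: (i) For any $n,k\in\mathbb N$, $$\sum_{j=0}^{2^k-1}\bigl(C^k(n+j+2^k)-C^k(n+j)\bigr)=(1+\alpha)^k.$$ (ii) For $n,k,m\in\mathbb N$ put $$s_k(n)=\sum_{j=0}^{2^k-1}C^k(n+j),\qquad s_{k,m}(n)=\sum_{j=0}^{2^k-1}C^k(n+j+m2^k).$$ If $\alpha\ge3$, then $$1+\frac{2}{\alpha}m\le\liminf_{k\to\infty}\frac{s_{k,m}(n)}{s_k(n)}\le\limsup_{k\to\infty}\frac{s_{k,m}(n)}{s_k(n)}\le1+2\alpha m.$$ If $\alpha=1$, then $$1+\frac{2m}{1+2\beta}\le\liminf_{k\to\infty}\frac{s_{k,m}(n)}{s_k(n)}\le\limsup_{k\to\infty}\frac{s_{k,m}(n)}{s_k(n)}\le1+2m.$$ (iii) Let $m,n,k\in\mathbb N$ with $m\ge1$. Then $D_t^m(C^k(n))$ decomposes as a sum of terms with factor $C^k(n)$ and terms with no such factor (free terms): there are integers $A_m(i),B_m(i)$, $0\le i\le 2^m-1$, not depending on $n,k$, with $$D_t^m(C^k(n))=\frac1{2^m}\bigl(A_m(i)\,C^k(n)+B_m(i)\bigr)\quad\text{whenever } C^k(n)\equiv i \pmod{2^m}.$$ Moreover, the sum of the coefficients associated to $C^k(n)$ is $\sum_{i=0}^{2^m-1}A_m(i)=(\alpha-3)^m$, and the sum of the free ones is $\sum_{i=0}^{2^m-1}B_m(i)=\beta(\alpha-3)^{m-1}$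 (with the convention $0^0=1$).
   Context: $\mathbb N$ denotes the nonnegative integers. For $n\in\mathbb N$, $C(n)=C_{\alpha,\beta}(n)=n/2$ if $n$ is even and $C(n)=(\alpha n+\beta)/2$ if $n$ is odd; $C^k$ is the $k$-fold iterate, $C^0(n)=n$. The discrete time derivative of the Collatz orbit at stage $k$ is $D_t(C^k(n)):=C^{k+1}(n)-C^k(n)$, and for $m\ge1$ the $m$-th derivative is defined recursively by $D_t^m(C^k(n)):=D_tD_t^{m-1}(C^k(n))$, so that $D_t^m(C^k(n))=\sum_{j=0}^m\binom mj(-1)^jC^{k+m-j}(n)$. In item (iii), the coefficients are those of the affine expressions of $D_t^m(C^k(n))$ in terms of $x=C^k(n)$, one expression for each residue class of $x$ modulo $2^m$ (for each class $i$, the identity holds for all nonnegative integers $x\equiv i\pmod{2^m}$ in place of $C^k(n)$, with $D_t^m$ of $x$ meaning $\sum_{j=0}^m\binom mj(-1)^jC^{m-j}(x)$), written over the common denominator $2^m$, and the sums are over all $2^m$ classes. *)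

(* Defs.v *)
From mathcomp Require Import all_boot all_order all_algebra.
From mathcomp Require Import all_classical all_reals all_analysis.

Set Implicit Arguments.
Unset Strict Implicit.
Unset Printing Implicit Defensive.

Import Order.TTheory GRing.Theory Num.Theory.

Local Open Scope ring_scope.

(* The halving is exact as soon as [alpha] and [beta] are odd. *)
Definition collatz (alpha beta n : nat) : nat :=
  (if odd n then (alpha * n + beta)./2 else n./2)%N.

Definition collatz_iter (alpha beta k n : nat) : nat :=
  iter k (collatz alpha beta) n.

(* The discrete time derivative acts on the whole orbit k |-> C^k(n), so that
   it can be iterated; values may be negative, hence [int]. *)
Definition time_deriv (u : nat -> int) (k : nat) : int := u k.+1 - u k.

Definition collatz_deriv (alpha beta m k n : nat) : int :=
  iter m time_deriv (fun j : nat => (collatz_iter alpha beta j n)%:Z) k.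

Definition collatz_sum (alpha beta k n : nat) : nat :=
  (\sum_(j < 2 ^ k) collatz_iter alpha beta k (n + j))%N.

Definition collatz_shifted_sum (alpha beta k m n : nat) : nat :=
  (\sum_(j < 2 ^ k) collatz_iter alpha beta k (n + j + m * 2 ^ k))%N.

(* The limits inferior and superior below are taken in the extended reals.
   The ratio is well defined except for k = n = 0, where it has the junk value
   x / 0 = 0, which does not affect the limits. *)
Definition collatz_ratio (R : realType) (alpha beta m n k : nat) : \bar R :=
  ((collatz_shifted_sum alpha beta k m n)%:R
     / (collatz_sum alpha beta k n)%:R)%:E.

(* Main.v *)
Require Import Defs.
From mathcomp Require Import all_boot all_order all_algebra.
From mathcomp Require Import all_classical all_reals all_analysis.
From mathcomp Require Import zify ring.

Set Implicit Arguments.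
Unset Strict Implicit.
Unset Printing Implicit Defensive.

Import Order.TTheory GRing.Theory Num.Theory.

Local Open Scope ring_scope.

(** All three items rest on one fact: C maps the residues modulo 2^(k+1) onto
    the residues modulo 2^k two-to-one, each class being hit once by an even
    and once by an odd argument, because y |-> C(2y) = y and
    y |-> C(2y+1) = alpha y + (alpha+beta)/2 both permute the residues modulo
    2^k when alpha is odd. Hence summing F(C x) over a period, with weight v
    on even and w on odd x, multiplies the sum of a periodic F by v + w
    ([sum_comp_collatz]).

    Writing 2 C(x) = a(x) x + b(x), where (a, b) is (1, 0) on even and
    (alpha, beta) on odd arguments, the iterate C^k is affine on each class
    modulo 2^k, with slope E_k(x) / 2^k, where E_k(x) is the product of the
    a's along the first k points of the orbit. So C^k(x + q 2^k) = C^k(x) +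
    q E_k(x), and by the averaging fact E_k sums to (1+alpha)^k over a period.
    This is (i), and also gives s_{k,m}(n) = s_k(n) + m (1+alpha)^k.

    For (ii) it remains to locate s_k(n) / (1+alpha)^k. As E_k is odd, exactly
    one of C^k(y) and C^k(y + 2^k) is odd, so pairing y with y + 2^k in
    s_{k+1}(n) gives
      2 s_{k+1} = (1+alpha) s_k + beta 2^k + (a term between (1+alpha)^k and
      alpha (1+alpha)^k).
    After division by (1+alpha)^k this recurrence contracts by 1/2, with a
    beta term that vanishes in the limit if alpha >= 3 and is constant if
    alpha = 1. The resulting limit points lie strictly inside the claimed
    range, so the claimed bounds even hold for all large k.

    For (iii), D^(m+1) at x is D^m at C(x) minus D^m at x, which turns the
    affine expressions of D^m into those of D^(m+1). The averaging fact,
    applied to the recursions of the coefficients, multiplies the sum of the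
    A_m by (1+alpha) - 4 and shows that the B_(m+1) sum to beta times the sum
    of the A_m. *)

(** * Sums of periodic functions *)

Definition periodic_mod (T : Type) (N : nat) (F : nat -> T) : Prop :=
  forall x q, F (x + q * N)%N = F x.

Lemma periodic_mod_eq (T : Type) (N : nat) (F : nat -> T) x y :
  periodic_mod N F -> x = y %[mod N] -> F x = F y.
Proof.
move=> F_per xy.
by rewrite (divn_eq x N) (divn_eq y N) ![(_ * N + _)%N]addnC !F_per xy.
Qed.

Lemma periodic_mod_dvd (T : Type) (M N : nat) (F : nat -> T) :
  (N %| M)%N -> periodic_mod N F -> periodic_mod M F.
Proof. by move=> /dvdnP[d ->] F_per x q; rewrite mulnA F_per. Qed.

(** The affine map j |-> a j + c permutes the residues modulo N. *)
Lemma sum_periodic_affine (V : nmodType) (N a c : nat) (F : nat -> V) :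
  coprime a N -> periodic_mod N F ->
  \sum_(j < N) F (a * j + c)%N = \sum_(j < N) F j.
Proof.
case: N => [|N] coaN F_per; first by rewrite !big_ord0.
pose h (j : 'I_N.+1) : 'I_N.+1 := Ordinal (ltn_pmod (a * j + c) (ltn0Sn N)).
have h_inj : injective h.
  move=> i j /(congr1 val) /= /eqP.
  rewrite eqn_modDr.
  wlog le_ji : i j / (j <= i)%N => [W|].
    by case/orP: (leq_total j i) => /W // W' e; apply/esym/W'; rewrite eq_sym.
  rewrite eqn_mod_dvd ?leq_mul2l ?le_ji ?orbT // -mulnBr.
  rewrite mulnC Gauss_dvdl 1?coprime_sym // => dvd_ij; apply/val_inj => /=.
  have lt_ij : (i - j < N.+1)%N by apply: leq_ltn_trans (leq_subr _ _) _.
  by move: dvd_ij; rewrite /dvdn modn_small // => /eqP; lia.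
rewrite [RHS](reindex_inj h_inj); apply: eq_bigr => j _ /=.
by apply: periodic_mod_eq F_per _; rewrite modn_mod.
Qed.

Lemma sum_periodic_window (V : nmodType) (N n : nat) (F : nat -> V) :
  periodic_mod N F -> \sum_(j < N) F (n + j)%N = \sum_(j < N) F j.
Proof.
move=> F_per; rewrite -[RHS](sum_periodic_affine n (coprime1n N) F_per).
by apply: eq_bigr => j _; rewrite mul1n addnC.
Qed.

Lemma sum_ord_double (V : nmodType) (N : nat) (F : nat -> V) :
  \sum_(j < 2 * N) F j = \sum_(j < N) (F (2 * j)%N + F (2 * j).+1).
Proof.
elim: N => [|N IHN]; first by rewrite !big_ord0.
by rewrite mulnS !big_ord_recr /= IHN addrA.
Qed.

Lemma sum_periodic_double (V : nmodType) (N : nat) (F : nat -> V) :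
  periodic_mod N F ->
  \sum_(j < 2 * N) F j = \sum_(j < N) F j + \sum_(j < N) F j.
Proof.
move=> F_per; rewrite [(2 * N)%N]mul2n -addnn big_split_ord /=; congr (_ + _).
by apply: eq_bigr => j _; have := F_per j 1; rewrite mul1n addnC.
Qed.

(** * Collatz iterates on residue classes *)

Section CollatzIterates.

Variables alpha beta : nat.
Hypotheses (alpha_odd : odd alpha) (beta_odd : odd beta).

Local Notation C := (collatz alpha beta).
Local Notation Ck := (collatz_iter alpha beta).

Definition slope (x : nat) : nat := if odd x then alpha else 1.

Definition offset (x : nat) : nat := if odd x then beta else 0.

Lemma odd_addn_2pow x q k : odd (x + q * 2 ^ k.+1) = odd x.
Proof. by rewrite oddD expnS oddM oddM andbF addbF. Qed.

Lemma double_collatz x : (2 * C x = slope x * x + offset x)%N.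
Proof.
rewrite /collatz /slope /offset; case: ifP => xodd; last first.
  by rewrite mul1n addn0 mul2n halfK xodd subn0.
by rewrite mul2n halfK oddD oddM alpha_odd xodd beta_odd subn0.
Qed.

Lemma collatz_shift x q k :
  C (x + q * 2 ^ k.+1) = (C x + q * slope x * 2 ^ k)%N.
Proof.
have := double_collatz (x + q * 2 ^ k.+1).
rewrite /slope /offset odd_addn_2pow -/(slope x) -/(offset x) => e.
have := double_collatz x; rewrite expnS in e *; nia.
Qed.

Lemma periodic_slope k : periodic_mod (2 ^ k.+1) slope.
Proof. by move=> x q; rewrite /slope odd_addn_2pow. Qed.

Lemma periodic_offset k : periodic_mod (2 ^ k.+1) offset.
Proof. by move=> x q; rewrite /offset odd_addn_2pow. Qed.

Lemma periodic_comp_collatz (T : Type) k (F : nat -> T) :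
  periodic_mod (2 ^ k) F -> periodic_mod (2 ^ k.+1) (F \o C).
Proof. by move=> F_per x q; rewrite /= collatz_shift F_per. Qed.

(** Even arguments 2y are sent to y and odd arguments 2y+1 to
    alpha y + (alpha + beta)/2; either way y running over a period makes the
    image run over a period. *)
Lemma sum_comp_collatz (S : pzSemiRingType) (k : nat) (v w : S)
    (F : nat -> S) :
  periodic_mod (2 ^ k) F ->
  \sum_(x < 2 ^ k.+1) (if odd x then w else v) * F (C x)
  = (v + w) * \sum_(x < 2 ^ k) F x.
Proof.
move=> F_per; rewrite expnS.
rewrite (@sum_ord_double _ _ (fun x => (if odd x then w else v) * F (C x))).
rewrite big_split mulrDl /=; congr (_ + _).
  rewrite mulr_sumr; apply: eq_bigr => y _.
  by rewrite /collatz oddM /= mul2n doubleK.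
have coa2k : coprime alpha (2 ^ k) by rewrite coprimeXr // coprimen2.
rewrite -(sum_periodic_affine (alpha + beta)./2 coa2k F_per) mulr_sumr.
apply: eq_bigr => y _; rewrite oddM /=; congr (_ * F _).
by have := double_collatz (2 * y).+1; rewrite /slope /offset /= oddM /=; lia.
Qed.

(** This is alpha to the number of odd points among x, C x, ..., C^(k-1) x,
    that is, 2^k times the slope of C^k on the class of x modulo 2^k. *)
Fixpoint slope_prod (k x : nat) : nat :=
  if k is k'.+1 then slope x * slope_prod k' (C x) else 1.

Lemma periodic_slope_prod k : periodic_mod (2 ^ k) (slope_prod k).
Proof.
elim: k => [|k IHk] x q //=.
by rewrite (periodic_slope k) [slope_prod k _](periodic_comp_collatz IHk).
Qed.

(** Hence C^k(x) and C^k(x + 2^k) have opposite parities. *)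
Lemma odd_slope_prod k x : odd (slope_prod k x).
Proof.
by elim: k x => //= k IHk x; rewrite oddM IHk andbT /slope; case: ifP.
Qed.

Lemma sum_slope_prod k : (\sum_(x < 2 ^ k) slope_prod k x = (1 + alpha) ^ k)%N.
Proof.
elim: k => [|k IHk]; first by rewrite big_ord_recl big_ord0.
rewrite [RHS]expnS -IHk.
exact: (@sum_comp_collatz nat k 1%N alpha _ (@periodic_slope_prod k)).
Qed.

Lemma collatz_iter_shift k x q :
  Ck k (x + q * 2 ^ k) = (Ck k x + q * slope_prod k x)%N.
Proof.
elim: k x q => [|k IHk] x q; first by rewrite /= !muln1.
by rewrite /collatz_iter !iterSr -!/(Ck _ _) collatz_shift IHk mulnA.
Qed.

(** Each term of the shifted sum exceeds the unshifted one by m E_k, and E_k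
    has the same sum over any window of length 2^k. *)
Lemma collatz_shifted_sumE k m n :
  collatz_shifted_sum alpha beta k m n
  = (collatz_sum alpha beta k n + m * (1 + alpha) ^ k)%N.
Proof.
rewrite /collatz_shifted_sum /collatz_sum.
under eq_bigr => j _ do rewrite collatz_iter_shift.
rewrite big_split /= -big_distrr /= -sum_slope_prod; congr (_ + _ * _)%N.
exact: (@sum_periodic_window nat _ n _ (@periodic_slope_prod k)).
Qed.

(** Since z and z + e have opposite parities, one of them is multiplied by
    alpha and the other is not; the larger one, z + e, gets the factor alpha
    exactly when z is even, whence the slope at z + 1. *)
Lemma double_collatz_pair z e : odd e ->
  (2 * (C z + C (z + e)) = (1 + alpha) * z + beta + e * slope z.+1)%N.
Proof.
move=> e_odd; rewrite mulnDr !double_collatz /slope /offset oddD e_odd /=.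
by case: (odd z) => /=; nia.
Qed.

(** The window of length 2^(k+1) is cut into the pairs (y, y + 2^k), to which
    [double_collatz_pair] applies with e = E_k(y). *)
Lemma double_collatz_sumS k n :
  (2 * collatz_sum alpha beta k.+1 n
   = (1 + alpha) * collatz_sum alpha beta k n + beta * 2 ^ k
     + \sum_(j < 2 ^ k) slope_prod k (n + j) * slope (Ck k (n + j)).+1)%N.
Proof.
rewrite /collatz_sum expnS [(2 * 2 ^ k)%N]mul2n -addnn big_split_ord /=.
rewrite -big_split /=.
have -> : (beta * 2 ^ k = \sum_(j < 2 ^ k) beta)%N.
  by rewrite sum_nat_const card_ord mulnC.
rewrite !big_distrr -!big_split /=; apply: eq_bigr => j _.
rewrite -double_collatz_pair ?odd_slope_prod //.
rewrite [(2 ^ k + j)%N]addnC addnA.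
by have := collatz_iter_shift k (n + j) 1; rewrite !mul1n => ->.
Qed.

(** * Growth of the window sums *)

Lemma collatz_sumS_ge k n : (0 < alpha)%N ->
  ((1 + alpha) * collatz_sum alpha beta k n + beta * 2 ^ k + (1 + alpha) ^ k
   <= 2 * collatz_sum alpha beta k.+1 n)%N.
Proof.
move=> alpha_gt0; rewrite double_collatz_sumS leq_add2l.
rewrite -sum_slope_prod.
rewrite -(@sum_periodic_window nat _ n _ (@periodic_slope_prod k)).
by apply: leq_sum => j _; rewrite leq_pmulr // /slope; case: ifP.
Qed.

Lemma collatz_sumS_le k n : (0 < alpha)%N ->
  (2 * collatz_sum alpha beta k.+1 n
   <= (1 + alpha) * collatz_sum alpha beta k n + beta * 2 ^ k
      + alpha * (1 + alpha) ^ k)%N.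
Proof.
move=> alpha_gt0; rewrite double_collatz_sumS leq_add2l.
rewrite -sum_slope_prod.
rewrite -(@sum_periodic_window nat _ n _ (@periodic_slope_prod k)).
rewrite big_distrr; apply: leq_sum => j _ /=.
by rewrite mulnC leq_mul2r /slope; case: ifP; rewrite ?leqnn ?alpha_gt0 orbT.
Qed.

(** With t_k = s_k / (1+alpha)^k, [collatz_sumS_ge] yields
    t_(k+1) >= t_k / 2 + 1 / (2 (1+alpha)), whose fixed point is
    1 / (1+alpha): so t_k >= (1 - 2^-k) / (1+alpha), here cleared of
    denominators. *)
Lemma collatz_sum_lower k n : (0 < alpha)%N ->
  (2 ^ k * (1 + alpha) ^ k
   <= (1 + alpha) * (2 ^ k * collatz_sum alpha beta k n) + (1 + alpha) ^ k)%N.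
Proof.
move=> alpha_gt0; elim: k => [|k IHk]; first by rewrite !expn0; lia.
have := collatz_sumS_ge k n alpha_gt0; rewrite !expnS.
move: IHk; set P := ((1 + alpha) ^ k)%N; set T := (2 ^ k)%N.
set s := collatz_sum _ _ k n; set s' := collatz_sum _ _ k.+1 n => IHk rec.
have {}rec : ((1 + alpha) * s + P <= 2 * s')%N by lia.
(* Linear reasoning treats products as atoms, so each multiplication of an
   inequality by a nonnegative factor is done by hand. *)
have {}rec := leq_mul (leqnn T) rec.
have {}rec : (2 * (T * P) <= T * (2 * s') + P)%N by lia.
have {}rec := leq_mul (leqnn (1 + alpha)) rec; lia.
Qed.

(** With t_k = s_k / (1+alpha)^k, the claim reads
    t_k <= 1 + (n + k beta) / 2^k. The fixed point of the recurrence
    without its beta term is alpha / (1+alpha), replaced by the simpler 1,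
    which is still below the target alpha / 2 for alpha >= 3; the inequality
    4^k <= (1+alpha)^k makes the beta terms add up to at most k beta / 2^k. *)
Lemma collatz_sum_upper k n : (3 <= alpha)%N ->
  (2 ^ k * collatz_sum alpha beta k n
   <= (1 + alpha) ^ k * (2 ^ k + n + k * beta))%N.
Proof.
move=> alpha_ge3; elim: k => [|k IHk].
  by rewrite /collatz_sum big_ord_recl big_ord0 /=; lia.
have := collatz_sumS_le k n (ltnW (ltnW alpha_ge3)).
have : (2 ^ k * 2 ^ k <= (1 + alpha) ^ k)%N.
  by rewrite -expnMn; case: k {IHk} => // k; rewrite leq_exp2r; lia.
rewrite !expnS; move: IHk.
set P := ((1 + alpha) ^ k)%N; set T := (2 ^ k)%N.
set s := collatz_sum _ _ k n; set s' := collatz_sum _ _ k.+1 n => IHk TP rec.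
have rec' : (T * (2 * s')
    <= (1 + alpha) * (T * s) + beta * (T * T) + alpha * (T * P))%N.
  apply: leq_trans (leq_mul (leqnn T) rec) _; lia.
have {}IHk := leq_mul (leqnn (1 + alpha)) IHk.
have {}TP := leq_mul (leqnn beta) TP.
have : (beta * P <= (1 + alpha) * (beta * P))%N by rewrite leq_pmull.
lia.
Qed.

(** For alpha = 1 the two bounds on s_(k+1) coincide, so the recurrence
    2 s_(k+1) = 2 s_k + (1 + beta) 2^k is exact and can be solved. *)
Lemma collatz_sum_alpha1 k n : alpha = 1%N ->
  (2 * collatz_sum alpha beta k n + (1 + beta)
   = (1 + beta) * 2 ^ k + 2 * n)%N.
Proof.
move=> alpha1; elim: k => [|k IHk].
  by rewrite /collatz_sum big_ord_recl big_ord0 /= expn0; lia.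
have := collatz_sumS_ge k n; have := collatz_sumS_le k n.
rewrite alpha1 -[(1 + 1)%N]/2%N expnS in IHk * => /(_ isT) ? /(_ isT) ?; lia.
Qed.

Lemma sqr_le_2pow k : (4 <= k)%N -> (k * k <= 2 ^ k)%N.
Proof.
elim: k => // k IHk; rewrite leq_eqVlt => /predU1P[<- //|k_ge4].
have {}k_ge4 : (4 <= k)%N by [].
by rewrite expnS; apply: leq_trans (leq_mul (leqnn 2) (IHk k_ge4)); nia.
Qed.

(** The threshold on k makes the error (n + k beta) / 2^k of
    [collatz_sum_upper] at most 1/2 (through k^2 <= 2^k), so that
    t_k <= 3/2 <= alpha/2, and the factor 1 - 2^-k of [collatz_sum_lower] at
    least 3/4, where 2/3 would suffice at alpha = 3. *)
Lemma collatz_sum_bounds_alpha_ge3 k n :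
  (3 <= alpha)%N -> (maxn 4 (2 * (n + beta)) <= k)%N ->
  (2 * collatz_sum alpha beta k n <= alpha * (1 + alpha) ^ k)%N /\
  ((1 + alpha) ^ k <= 2 * alpha * collatz_sum alpha beta k n)%N.
Proof.
move=> alpha_ge3; rewrite geq_max => /andP[k_ge4 k_ge].
have err : (2 * (n + k * beta) <= 2 ^ k)%N.
  by apply: leq_trans (sqr_le_2pow k_ge4); nia.
have up := collatz_sum_upper k n alpha_ge3.
have lo := collatz_sum_lower k n (ltnW (ltnW alpha_ge3)).
have T_ge4 : (4 <= 2 ^ k)%N by rewrite (@leq_exp2l 2 2 k) // ltnW // ltnW.
move: up lo err T_ge4; set T := (2 ^ k)%N; set P := ((1 + alpha) ^ k)%N.
set s := collatz_sum _ _ _ _ => up lo err T_ge4.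
have T_gt0 : (0 < T)%N by exact: leq_trans T_ge4.
split; rewrite -(leq_pmul2l T_gt0).
  have {}err := leq_mul (leqnn P) err.
  have {}alpha_ge3 := leq_mul (leqnn (P * T)) alpha_ge3.
  lia.
have {}T_ge4 := leq_mul (leqnn P) T_ge4.
have {}alpha_ge3 := leq_mul (leqnn (T * s)) alpha_ge3.
lia.
Qed.

(** Here t_k tends to (1 + beta) / 2, which lies strictly between 1/2 and
    (1 + 2 beta) / 2 because beta > 0. *)
Lemma collatz_sum_bounds_alpha1 k n :
  alpha = 1%N -> (2 * n < k)%N ->
  (2 * collatz_sum alpha beta k n <= (1 + 2 * beta) * (1 + alpha) ^ k)%N /\
  ((1 + alpha) ^ k <= 2 * 1 * collatz_sum alpha beta k n)%N.
Proof.
move=> alpha1 n_lt_k; have := collatz_sum_alpha1 k n alpha1.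
have beta_gt0 := odd_gt0 beta_odd.
have := leq_ltn_trans n_lt_k (ltn_expl k (isT : (1 < 2)%N)).
rewrite alpha1 -[(1 + 1)%N]/2%N; move: (2 ^ k)%N => T T_gt sE.
have := leq_mul (leqnn beta) T_gt.
have : (n <= beta * n)%N by rewrite leq_pmull.
by split; lia.
Qed.

(** * Time derivatives on residue classes *)

(** If 2^m D^m(x) = A(x) x + B(x), then doubling D^m(C x) - D^m(x) and
    replacing 2 C(x) by slope x * x + offset x gives the two recursions below.
    The functions take x itself rather than its class; that they only depend
    on x modulo 2^m is shown afterwards. *)
Fixpoint deriv_coef (m x : nat) : int :=
  if m is m'.+1
  then (slope x)%:Z * deriv_coef m' (C x) - 2 * deriv_coef m' x
  else 1.

Fixpoint deriv_free (m x : nat) : int :=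
  if m is m'.+1
  then (offset x)%:Z * deriv_coef m' (C x)
       + 2 * (deriv_free m' (C x) - deriv_free m' x)
  else 0.

Lemma collatz_deriv_affine m k n :
  2 ^+ m * collatz_deriv alpha beta m k n
  = deriv_coef m (Ck k n) * (Ck k n)%:Z + deriv_free m (Ck k n).
Proof.
elim: m k => [|m IHm] k; first by rewrite /= !mul1r addr0.
have -> : collatz_deriv alpha beta m.+1 k n
  = collatz_deriv alpha beta m k.+1 n - collatz_deriv alpha beta m k n by [].
have -> : 2 ^+ m.+1 * (collatz_deriv alpha beta m k.+1 n
                       - collatz_deriv alpha beta m k n)
  = 2 * (2 ^+ m * collatz_deriv alpha beta m k.+1 n
         - 2 ^+ m * collatz_deriv alpha beta m k n) by rewrite exprS; ring.
rewrite !IHm -[Ck k.+1 n]/(C (Ck k n)) /=; set x := Ck k n.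
have CxE : 2 * (C x)%:Z = (slope x)%:Z * x%:Z + (offset x)%:Z.
  by have := double_collatz x; lia.
transitivity (deriv_coef m (C x) * (2 * (C x)%:Z) + 2 * deriv_free m (C x)
  - 2 * (deriv_coef m x * x%:Z + deriv_free m x)); first by ring.
by rewrite CxE; ring.
Qed.

Lemma periodic_deriv_coef m : periodic_mod (2 ^ m) (deriv_coef m).
Proof.
elim: m => [|m IHm] x q //=.
rewrite (periodic_slope m) [deriv_coef m (C _)](periodic_comp_collatz IHm).
by rewrite (periodic_mod_dvd (dvdn_exp2l 2 (leqnSn m)) IHm).
Qed.

Lemma periodic_deriv_free m : periodic_mod (2 ^ m) (deriv_free m).
Proof.
elim: m => [|m IHm] x q //=.
rewrite (periodic_offset m) [deriv_free m (C _)](periodic_comp_collatz IHm).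
rewrite [deriv_coef m _](periodic_comp_collatz (@periodic_deriv_coef m)).
by rewrite (periodic_mod_dvd (dvdn_exp2l 2 (leqnSn m)) IHm).
Qed.

(** Of the two terms of the recursion, the first multiplies the sum by
    1 + alpha by averaging; in the second each class modulo 2^m is counted
    twice modulo 2^(m+1), with weight 2, hence the -4. *)
Lemma sum_deriv_coef m :
  \sum_(x < 2 ^ m) deriv_coef m x = (alpha%:Z - 3) ^+ m.
Proof.
elim: m => [|m IHm]; first by rewrite big_ord_recl big_ord0.
rewrite sumrB /= -mulr_sumr.
have -> : \sum_(x < 2 ^ m.+1) deriv_coef m x = 2 * (alpha%:Z - 3) ^+ m.
  by rewrite expnS sum_periodic_double ?IHm; [ring|exact: periodic_deriv_coef].
under eq_bigr => x _ do rewrite /slope fun_if.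
by rewrite (sum_comp_collatz _ _ (@periodic_deriv_coef m)) IHm exprS; ring.
Qed.

(** Averaging with weights (1, 1) doubles the sum of the old free terms, just
    as the doubled period does, so these contributions cancel; only the odd
    classes contribute, with weight beta. *)
Lemma sum_deriv_free m :
  \sum_(x < 2 ^ m.+1) deriv_free m.+1 x = beta%:Z * (alpha%:Z - 3) ^+ m.
Proof.
rewrite big_split /= -mulr_sumr sumrB.
have -> : \sum_(x < 2 ^ m.+1) deriv_free m x
    = 2 * \sum_(x < 2 ^ m) deriv_free m x.
  by rewrite expnS sum_periodic_double; [ring|exact: periodic_deriv_free].
have -> : \sum_(x < 2 ^ m.+1) deriv_free m (C x)
    = 2 * \sum_(x < 2 ^ m) deriv_free m x.
  rewrite -[2]/(1 + 1) -(sum_comp_collatz 1 1 (@periodic_deriv_free m)).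
  by apply: eq_bigr => x _; rewrite if_same mul1r.
under eq_bigr => x _ do rewrite /offset fun_if.
rewrite (sum_comp_collatz _ _ (@periodic_deriv_coef m)) sum_deriv_coef; ring.
Qed.

End CollatzIterates.

(** * Limits of the ratio of window sums *)

Lemma limn_esup_le_eventually (R : realType) (u : nat -> \bar R) (c : \bar R)
    (N : nat) :
  (forall k, (N <= k)%N -> (u k <= c)%E) -> (limn_esup u <= c)%E.
Proof.
move=> u_le; rewrite /limn_esup limf_esupE.
apply: (@le_trans _ _ (ereal_sup (u @` [set k | (N <= k)%N])%classic)).
  apply: ereal_inf_lbound.
  by exists [set k | (N <= k)%N]%classic => //; exists N.
by apply: ge_ereal_sup => _ [k Nk <-]; exact: u_le.
Qed.

Lemma limn_einf_ge_eventually (R : realType) (u : nat -> \bar R) (c : \bar R)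
    (N : nat) :
  (forall k, (N <= k)%N -> (c <= u k)%E) -> (c <= limn_einf u)%E.
Proof.
move=> u_ge; rewrite /limn_einf leeNr.
apply: (@limn_esup_le_eventually _ _ _ N).
by move=> k /u_ge; rewrite leeN2.
Qed.

(** The ratio is 1 + m (1+alpha)^k / s_k, so it suffices to bound
    (1+alpha)^k / s_k between 2/p and 2q. *)
Lemma collatz_ratio_limits (R : realType) (alpha beta p q m n N : nat) :
  odd alpha -> odd beta -> (0 < p)%N ->
  (forall k, (N <= k)%N ->
     (2 * collatz_sum alpha beta k n <= p * (1 + alpha) ^ k)%N /\
     ((1 + alpha) ^ k <= 2 * q * collatz_sum alpha beta k n)%N) ->
  [/\ ((1 + 2 / p%:R * m%:R)%:E
         <= limn_einf (collatz_ratio R alpha beta m n))%E,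
      (limn_einf (collatz_ratio R alpha beta m n)
         <= limn_esup (collatz_ratio R alpha beta m n))%E
    & (limn_esup (collatz_ratio R alpha beta m n)
         <= (1 + 2 * q%:R * m%:R)%:E)%E].
Proof.
move=> alpha_odd beta_odd p_gt0 bounds.
have s_gt0 k : (N <= k)%N -> (0 < collatz_sum alpha beta k n)%N.
  move=> /bounds[_]; apply: contraTT; rewrite -!ltnNge ltnS leqn0 => /eqP ->.
  by rewrite muln0 expn_gt0.
have ratioE k : (N <= k)%N -> collatz_ratio R alpha beta m n k
    = (1 + (1 + alpha)%:R ^+ k / (collatz_sum alpha beta k n)%:R * m%:R)%:E.
  move=> /s_gt0 s_pos; rewrite /collatz_ratio collatz_shifted_sumE //.
  have s_neq0 : (collatz_sum alpha beta k n)%:R != 0 :> R.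
    by rewrite pnatr_eq0; lia.
  by rewrite -natrX natrD natrM; congr EFin; field.
split.
- apply: (@limn_einf_ge_eventually _ _ _ N) => k Nk.
  rewrite ratioE // lee_fin lerD2l ler_wpM2r //.
  rewrite ler_pdivlMr ?ltr0n ?s_gt0 // mulrAC ler_pdivrMr ?ltr0n //.
  by rewrite -natrX -!natrM ler_nat mulnC; case: (bounds k Nk); lia.
- exact: limn_einf_sup.
- apply: (@limn_esup_le_eventually _ _ _ N) => k Nk.
  rewrite ratioE // lee_fin lerD2l ler_wpM2r //.
  rewrite ler_pdivrMr ?ltr0n ?s_gt0 //.
  by rewrite -natrX -!natrM ler_nat; case: (bounds k Nk).
Qed.

Theorem theorem1p2 (R : realType) (alpha beta : nat)
    (alpha_gt0 : (0 < alpha)%N) (beta_gt0 : (0 < beta)%N)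
    (alpha_odd : odd alpha) (beta_odd : odd beta)
    (alpha_beta_coprime : coprime alpha beta) :
  (forall n k : nat,
     \sum_(j < 2 ^ k) ((collatz_iter alpha beta k (n + j + 2 ^ k))%:Z
                       - (collatz_iter alpha beta k (n + j))%:Z)
     = (1 + alpha%:Z) ^+ k)
  /\
  (forall n m : nat,
     ((3 <= alpha)%N ->
        [/\ ((1 + 2 / alpha%:R * m%:R)%:E
               <= limn_einf (collatz_ratio R alpha beta m n))%E,
            (limn_einf (collatz_ratio R alpha beta m n)
               <= limn_esup (collatz_ratio R alpha beta m n))%E
          & (limn_esup (collatz_ratio R alpha beta m n)
               <= (1 + 2 * alpha%:R * m%:R)%:E)%E])
     /\
     (alpha = 1%N ->
        [/\ ((1 + 2 * m%:R / (1 + 2 * beta%:R))%:E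
               <= limn_einf (collatz_ratio R alpha beta m n))%E,
            (limn_einf (collatz_ratio R alpha beta m n)
               <= limn_esup (collatz_ratio R alpha beta m n))%E
          & (limn_esup (collatz_ratio R alpha beta m n)
               <= (1 + 2 * m%:R)%:E)%E]))
  /\
  (forall m : nat, (1 <= m)%N ->
     exists A B : 'I_(2 ^ m) -> int,
       [/\ (forall (n k : nat) (i : 'I_(2 ^ m)),
              collatz_iter alpha beta k n = i %[mod 2 ^ m] ->
              (collatz_deriv alpha beta m k n)%:~R
              = (2 ^+ m)^-1
                * (A i * (collatz_iter alpha beta k n)%:Z + B i)%:~R :> rat),
           \sum_(i < 2 ^ m) A i = (alpha%:Z - 3) ^+ m
         & \sum_(i < 2 ^ m) B i = beta%:Z * (alpha%:Z - 3) ^+ m.-1]).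
Proof.
split=> [n k|].
  rewrite sumrB; apply/eqP; rewrite subr_eq; apply/eqP.
  have := collatz_shifted_sumE alpha_odd beta_odd k 1 n.
  rewrite /collatz_shifted_sum /collatz_sum !mul1n => /(congr1 Posz).
  rewrite PoszD !(big_morph Posz PoszD (erefl _)) => ->.
  by rewrite addrC -[Posz (_ ^ k)]natz natrX natrD !natz.
split=> [n m|[//|m] _].
  split=> [alpha_ge3|alpha1].
    exact: collatz_ratio_limits alpha_odd beta_odd alpha_gt0
      (fun k => collatz_sum_bounds_alpha_ge3 alpha_odd beta_odd alpha_ge3).
  have [lo mid up] := collatz_ratio_limits (p := 1 + 2 * beta) R m
    alpha_odd beta_odd isT
    (fun k => @collatz_sum_bounds_alpha1 _ _ alpha_odd beta_odd k n alpha1).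
  split=> //; last by rewrite mulr1 in up.
  by move: lo; rewrite mulrAC natrD natrM.
exists (fun i => deriv_coef alpha beta m.+1 i).
exists (fun i => deriv_free alpha beta m.+1 i).
split; [move=> n k i xi|exact: sum_deriv_coef|exact: sum_deriv_free].
rewrite -(periodic_mod_eq (periodic_deriv_coef alpha_odd beta_odd m.+1) xi).
rewrite -(periodic_mod_eq (periodic_deriv_free alpha_odd beta_odd m.+1) xi).
rewrite -collatz_deriv_affine // rmorphM rmorphXn /= mulKf //.
Qed.
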